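(* Let $I$ be a non-trivial admissible ideal in $\mathbb{N}$, let $x=\{x_k\}_{k\in\mathbb{N}}$ be a sequence of real numbers, and let $A$ be a compact set in $\mathbb{R}$ with $A\cap\Gamma_x^S(I)=\emptyset$. Then the set $\{k\in\mathbb{N}:x_k\in A\}$ has $I$-asymptotic density zero, i.e. $d_I(\{k\in\mathbb{N}:x_k\in A\})=0$.
   Context: $\mathbb{N}$ is the set of positive integers. An ideal $I$ in $\mathbb{N}$ is a class of subsets of $\mathbb{N}$ containing $\emptyset$ and closed under finite unions and under taking subsets; it is non-trivial if $\mathbb{N}\notin I$ and admissible if $\{n\}\in I$ for every $n\in\mathbb{N}$. A real sequence $\{a_n\}$ is $I$-convergent to $a$ ($I\text{-}\lim a_n=a$) if $\{n:|a_n-a|\ge\varepsilon\}\in I$ for every $\varepsilon>0$. For $K\subset\mathbb{N}$, the $I$-asymptotic density is $d_I(K)=I\text{-}\lim_{n\to\infty}\frac{|\{j\in K:j\le n\}|}{n}$, when this $I$-limit exists. ''$K$ does not have $I$-asymptotic density zero'' means that it is not the case that $d_I(K)$ exists and equals $0$ (so either $d_I(K)$ is positive or $d_I(K)$ does not exist). A real number $y$ is an $I$-statistical cluster point of $x$ if for every $\varepsilon>0$ the set $\{k\in\mathbb{N}:|x_k-y|<\varepsilon\}$ does not have $I$-asymptotic density zero; $\Gamma_x^S(I)$ is the set of all $I$-statistical cluster points of $x$. *)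

(* Defs.v *)
From mathcomp Require Import all_boot all_order all_algebra finmap.
From mathcomp Require Import all_classical all_reals all_analysis.
Import Order.TTheory GRing.Theory Num.Theory.
Import numFieldNormedType.Exports.

Set Implicit Arguments.
Unset Strict Implicit.
Unset Printing Implicit Defensive.

Local Open Scope classical_set_scope.
Local Open Scope ring_scope.

(* The positive integers: x 0 is not a term of a sequence, and the ratios
   below never divide by 0. *)
Definition posint : Type := {n : nat | (0 < n)%N}.

Definition ideal (I : set (set posint)) : Prop :=
  [/\ I set0, setU_closed I & forall A B, B `<=` A -> I A -> I B].

Definition nontrivial_ideal (I : set (set posint)) : Prop := ~ I setT.

Definition admissible_ideal (I : set (set posint)) : Prop :=
  forall n : posint, I [set n].

Definition ideal_cvg_to (R : realType) (I : set (set posint))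
    (a : posint -> R) (l : R) : Prop :=
  forall e : R, 0 < e -> I [set n | e <= `|a n - l|].

Definition initial_part (K : set posint) (n : posint) : set posint :=
  [set j | K j /\ (val j <= val n)%N].

(* fset_set returns the empty finite set on infinite sets; this does not
   occur in prefix_ratio. *)
Lemma finite_initial_part (K : set posint) (n : posint) :
  finite_set (initial_part K n).
Proof.
apply: (@sub_finite_set _ _ (val @^-1` `I_(val n).+1)).
  by move=> j [_ jn]; rewrite /= ltnS.
by apply: finite_preimage; [move=> i j _ _; exact: val_inj|exact: finite_II].
Qed.

Definition prefix_ratio (R : realType) (K : set posint) (n : posint) : R :=
  (#|` fset_set (initial_part K n)|)%fset%:R / (val n)%:R.

(* d_I(K) exists and equals d; such a d is unique when I is a non-trivial
   ideal. *)
Definition has_ideal_density (R : realType) (I : set (set posint))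
    (K : set posint) (d : R) : Prop :=
  ideal_cvg_to I (prefix_ratio R K) d.

Definition ideal_stat_cluster_points (R : realType) (I : set (set posint))
    (x : posint -> R) : set R :=
  [set y | forall e : R, 0 < e ->
     ~ has_ideal_density I [set k | `|x k - y| < e] (0 : R)].

(* Main.v *)
Require Import Defs.
From mathcomp Require Import all_boot all_order all_algebra finmap.
From mathcomp Require Import all_classical all_reals all_analysis.
Import Order.TTheory GRing.Theory Num.Theory.
Import numFieldNormedType.Exports.

Local Open Scope classical_set_scope.
Local Open Scope ring_scope.

(* The sets of I-density zero form an ideal. A point of A is not a
   cluster point, so it has an open neighbourhood U with {k | x_k \in U} of
   I-density zero; finitely many such U cover A. *)

Lemma prefix_ratio_ge0 (R : realType) (K : set posint) (n : posint) :
  0 <= prefix_ratio R K n.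
Proof. by rewrite divr_ge0. Qed.

Lemma prefix_ratio_set0 (R : realType) (n : posint) :
  prefix_ratio R set0 n = 0.
Proof.
rewrite /prefix_ratio.
have -> : initial_part set0 n = set0 by apply/seteqP; split => // j [].
by rewrite fset_set0 cardfs0 mul0r.
Qed.

Lemma prefix_ratio_le (R : realType) (K L : set posint) (n : posint) :
  K `<=` L -> prefix_ratio R K n <= prefix_ratio R L n.
Proof.
move=> KL; rewrite ler_wpM2r ?invr_ge0// ler_nat fsubset_leq_card//.
rewrite -fset_set_sub; [|exact: finite_initial_part..].
by move=> j [Kj jn]; split; [exact: KL|].
Qed.

Lemma prefix_ratioU_le (R : realType) (K L : set posint) (n : posint) :
  prefix_ratio R (K `|` L) n <= prefix_ratio R K n + prefix_ratio R L n.
Proof.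
rewrite -mulrDl ler_wpM2r ?invr_ge0// -natrD ler_nat.
have -> : initial_part (K `|` L) n = initial_part K n `|` initial_part L n.
  apply/seteqP; split=> j.
    by move=> [[Kj|Lj] jn]; [left|right].
  by move=> [[Kj jn]|[Lj jn]]; split => //; [left|right].
rewrite fset_setU; [|exact: finite_initial_part..].
by rewrite cardfsU leq_subr.
Qed.

Lemma ideal_density0_set0 (R : realType) (I : set (set posint)) :
  ideal I -> has_ideal_density I set0 (0 : R).
Proof.
move=> [I0 _ I_sub] e e0; apply: I_sub I0 => n /=.
by rewrite prefix_ratio_set0 subrr normr0 leNgt e0.
Qed.

Lemma ideal_density0_sub (R : realType) (I : set (set posint))
    (K L : set posint) :
  ideal I -> K `<=` L ->
  has_ideal_density I L (0 : R) -> has_ideal_density I K (0 : R).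
Proof.
move=> [_ _ I_sub] KL L0 e e0; apply: I_sub (L0 e e0) => n /=.
rewrite !subr0 !ger0_norm ?prefix_ratio_ge0// => /le_trans; apply.
exact: prefix_ratio_le.
Qed.

(** If the ratio of the union reaches [e], subadditivity forces one of the two ratios to reach
    [e / 2]; the exceptional set thus lies in a union of two members of [I]. *)
Lemma ideal_density0_setU (R : realType) (I : set (set posint))
    (K L : set posint) :
  ideal I -> has_ideal_density I K (0 : R) -> has_ideal_density I L (0 : R) ->
  has_ideal_density I (K `|` L) (0 : R).
Proof.
move=> [_ I_setU I_sub] K0 L0 e e0.
have e20 : 0 < e / 2 by rewrite divr_gt0.
apply: I_sub (I_setU _ _ (K0 _ e20) (L0 _ e20)) => n /=.
rewrite !subr0 !ger0_norm ?prefix_ratio_ge0// => eKL.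
have [|Klt] := leP (e / 2) (prefix_ratio R K n); first by left.
have [|Llt] := leP (e / 2) (prefix_ratio R L n); first by right.
have := le_lt_trans (prefix_ratioU_le R K L n) (ltrD Klt Llt).
by rewrite -splitr ltNge eKL.
Qed.

Lemma ideal_density0_bigcup_fset (R : realType) (I : set (set posint))
    (J : choiceType) (D : {fset J}) (F : J -> set posint) :
  ideal I -> (forall i, i \in D -> has_ideal_density I (F i) (0 : R)) ->
  has_ideal_density I (\bigcup_(i in [set` D]) F i) (0 : R).
Proof.
move=> I_ideal F0; rewrite -bigsetU_fset_set// set_fsetK.
(* [big_seq] keeps the membership [i \in D], without which the hypothesis on [F i] could not be
   applied. *)
rewrite big_seq; elim/big_ind: _ => //.
- exact: ideal_density0_set0.
- by move=> K L; exact: ideal_density0_setU.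
Qed.

Theorem theorem3p3 (R : realType) (I : set (set posint))
    (I_ideal : ideal I) (I_nontrivial : nontrivial_ideal I)
    (I_admissible : admissible_ideal I)
    (x : posint -> R) (A : set R) (A_compact : compact A)
    (A_cluster : A `&` ideal_stat_cluster_points I x = set0) :
  has_ideal_density I [set k | A (x k)] (0 : R).
Proof.
pose null U := has_ideal_density I (x @^-1` U) (0 : R).
move: A_compact; rewrite compact_cover => A_compact.
(* The cover consists of all open null sets, each serving as its own index; no neighbourhood has to
   be chosen for each point. *)
have [||D D_null AD] := A_compact _ [set U | open U /\ null U] id.
- by move=> U [].
- move=> y Ay.
  (* Negating the cluster condition at [y] yields a radius [e] whose ball has a preimage of density
     zero. *)
  have /existsNP[e /not_implyP[e0 /contrapT ye]] :
      ~ ideal_stat_cluster_points I x y.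
    by move=> y_cluster; rewrite -[False]/(set0 y) -A_cluster.
  exists (ball y e); last exact: ballxx.
  split; first exact: ball_open.
  apply: ideal_density0_sub ye => // k.
  (* The ball measures [y - x k], the cluster condition [x k - y]. *)
  by rewrite /= -ball_normE /= distrC.
apply: (@ideal_density0_sub _ _ _ (\bigcup_(U in [set` D]) (x @^-1` U))) => //.
  by move=> k /AD.
apply: ideal_density0_bigcup_fset => // U /D_null.
by rewrite inE => -[].
Qed.
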